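(* Let $k\in\{2,3,4,5,6\}$ and let $n$ be any positive integer. Define $\ell:=\lfloor (k+1)^2/4\rfloor$ and $q:=n \bmod \ell$. Then \[ \nu_k(K_{k+1,n}) = q\binom{\frac{n-q}{\ell}+1}{2} + (\ell-q)\binom{\frac{n-q}{\ell}}{2}. \]
   Context: A book with $k$ pages consists of a line (the spine) and $k$ half-planes (the pages) whose common boundary is the spine. A $k$-page drawing of a graph places all vertices on the spine and draws each edge inside a single page (edges may cross). The $k$-page crossing number $\nu_k(G)$ is the minimum number of crossings over all $k$-page drawings of $G$. Convention: $\binom{a}{b}=0$ whenever $a<b$. *)

(* Defs.v *)
From mathcomp Require Import all_boot.
Set Implicit Arguments. Unset Strict Implicit. Unset Printing Implicit Defensive.

Definition Kvert (m n : nat) := ('I_m + 'I_n)%type.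
Definition Kedge (m n : nat) := ('I_m * 'I_n)%type.

(* A k-page book drawing: an injective placement of the vertices on the
   spine (positions in nat) and an assignment of each edge to one of the
   k pages.  Within a page, edges are drawn as arcs (semicircles); two
   edges on the same page cross (exactly once) iff their endpoints
   interleave along the spine. *)
Record book_drawing (k m n : nat) := BookDrawing {
  bd_pos : Kvert m n -> nat;
  bd_pos_inj : injective bd_pos;
  bd_page : Kedge m n -> 'I_k
}.

Definition left_end k m n (D : book_drawing k m n) (e : Kedge m n) : nat :=
  minn (bd_pos D (inl e.1)) (bd_pos D (inr e.2)).
Definition right_end k m n (D : book_drawing k m n) (e : Kedge m n) : nat :=
  maxn (bd_pos D (inl e.1)) (bd_pos D (inr e.2)).

(* e crosses f (counted once per unordered pair, via the left endpoint of e
   being the leftmost): same page and a_e < a_f < b_e < b_f. *)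
Definition crossing_pair k m n (D : book_drawing k m n) (e f : Kedge m n) : bool :=
  (bd_page D e == bd_page D f) &&
  [&& left_end D e < left_end D f, left_end D f < right_end D e
    & right_end D e < right_end D f].

Definition crossings k m n (D : book_drawing k m n) : nat :=
  #|[set p : Kedge m n * Kedge m n | crossing_pair D p.1 p.2]|.

Definition book_crossing_number_is (k m n c : nat) : Prop :=
  (exists D : book_drawing k m n, crossings D = c) /\
  (forall D : book_drawing k m n, c <= crossings D).

(* Main.v *)
Require Import Defs.
From mathcomp Require Import all_boot zify.
Set Implicit Arguments. Unset Strict Implicit. Unset Printing Implicit Defensive.

(** Write m = k+1 and join two blue vertices whenever their stars cross.  If
    K_{m,l+1} has no plane k-page drawing, every set of l+1 blue vertices spans
    an edge, and Turan's theorem gives the lower bound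
    sum_{i<n} floor(i/l), which is the stated value.  Conversely, in a plane
    drawing of K_{m,l} where each blue vertex repeats a page exactly once, one
    may replace each blue vertex by a run of clones: only clones of the same
    vertex cross, once per pair.

    A plane drawing of K_{m,l+1} amounts to a word in two letters (the colours
    along the spine) and a k-colouring of its bicoloured chords without
    monochromatic crossing.  This is impossible as soon as there is a multiset
    of more than k*a chords whose noncrossing subfamilies all have at most a
    members.  For m <= 7 every word contains, up to rotation and reflection,
    either m pairwise crossing chords (a = 1) or one of 28 multisets obtained by
    linear programming; both the values a and the covering of all words are
    checked by computation. *)

(** * Floor sums and Turan's theorem *)

Lemma sum_divn_shift l n : 0 < l ->
  \sum_(0 <= i < n) i %/ l = (n - l) + \sum_(0 <= i < n - l) i %/ l.
Proof.
move=> l_gt0.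
have small j : j <= l -> \sum_(0 <= i < j) i %/ l = 0.
  move=> le_jl; rewrite big_nat big1 // => i /andP[_ lt_ij].
  by rewrite divn_small // (leq_trans lt_ij).
case: (leqP n l) => [le_nl | /ltnW le_ln].
  by rewrite small //; move: le_nl; rewrite -subn_eq0 => /eqP->; rewrite big_geq.
rewrite (big_cat_nat (leq0n l) le_ln) /= small // -{1}[l]add0n big_addn add0n.
rewrite -[X in _ = X + _]muln1 -[X in X * 1]subn0 -sum_nat_const_nat -big_split /=.
by apply: eq_bigr => i _; rewrite divnDr ?dvdnn // divnn l_gt0 addnC.
Qed.

(** With s the quotient of n by l and q the remainder, each quotient below s occurs l times and s
    occurs q times; the value is the number of edges of q cliques on s+1 points and l-q cliques on s
    points. *)
Lemma sum_divn l n : 0 < l ->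
  \sum_(0 <= i < n) i %/ l = n %% l * 'C((n - n %% l) %/ l + 1, 2)
                      + (l - n %% l) * 'C((n - n %% l) %/ l, 2).
Proof.
move=> l_gt0.
have ->: (n - n %% l) %/ l = n %/ l by rewrite {1}(divn_eq n l) addnK mulnK.
rewrite {1}(divn_eq n l); have := ltn_pmod n l_gt0; move: (n %% l) (n %/ l) => q s lt_ql.
elim: s => [|s IHs].
  rewrite mul0n add0n big_nat big1 ?muln0 // => i /andP[_ lt_iq].
  by rewrite divn_small // (ltn_trans lt_iq).
rewrite sum_divn_shift // mulSn -addnA addKn IHs !addn1 !binS !bin1 !bin0.
case: s {IHs} => [|s]; rewrite ?binS ?bin1 ?bin0n ?bin0 /=; nia.
Qed.

Lemma leq_sum_divn l m n :
  m <= n -> \sum_(0 <= i < m) i %/ l <= \sum_(0 <= i < n) i %/ l.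
Proof. by move=> le_mn; rewrite (big_cat_nat (leq0n m) le_mn) leq_addr. Qed.

(* Greedy form of Turan's theorem: every vertex outside a maximal independent
   set sends an edge into it. *)
Lemma turan_edges (T : finType) (X : {set T * T}) l :
    0 < l -> (forall v, (v, v) \notin X) ->
    (forall I : {set T}, {in X, forall p, ~~ ((p.1 \in I) && (p.2 \in I))} -> #|I| <= l) ->
  forall A : {set T},
    \sum_(0 <= i < #|A|) i %/ l <= #|[set p in X | (p.1 \in A) && (p.2 \in A)]|.
Proof.
move=> l_gt0 X_irr small_indep A; have [n] := ubnP #|A|.
elim: n A => // n IHn A le_An; case: (set_0Vmem A) => [-> | [a aA]].
  by rewrite cards0 big_geq.
pose indep (I : {set T}) :=
  (I \subset A) && [forall p in X, ~~ ((p.1 \in I) && (p.2 \in I))].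
have indep_a: indep [set a].
  rewrite /indep sub1set aA; apply/forall_inP=> -[u v] uvX; rewrite !inE /=.
  by apply: contraL uvX => /andP[/eqP-> /eqP->].
have [I /maxsetP[/andP[sIA /forall_inP indI] maxI] /subsetP saI] := maxset_exists indep_a.
have{saI} aI: a \in I by rewrite saI ?inE.
have cardD: #|A :\: I| = #|A| - #|I| by rewrite cardsD (setIidPr sIA).
have I_gt0: 0 < #|I| by apply/card_gt0P; exists a.
have le_IA := subset_leq_card sIA.
have {}IHn := IHn (A :\: I) _; rewrite cardD in IHn.
pose E (B : {set T}) := [set p in X | (p.1 \in B) && (p.2 \in B)].
have sE: E (A :\: I) \subset E A.
  by apply/subsetP=> p; rewrite !inE => /and3P[-> /andP[_ ->] /andP[_ ->]].
rewrite -/(E A) -(cardsID (E (A :\: I)) (E A)) (setIidPr sE) addnC.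
apply: leq_trans (_ : (#|A| - #|I|) + \sum_(0 <= i < #|A| - #|I|) i %/ l <= _).
  rewrite sum_divn_shift // leq_add //; first by rewrite leq_sub2l ?small_indep.
  by rewrite leq_sum_divn // leq_sub2l ?small_indep.
apply: leq_add; last by apply: IHn; lia.
(* Each edge of [A] meeting [I] is charged to its endpoint outside [I]; by maximality of [I] the
   charges cover [A :\: I]. *)
pose g (p : T * T) := if p.1 \in I then p.2 else p.1.
rewrite -cardD; apply: leq_trans (leq_imset_card g _).
apply: subset_leq_card; apply/subsetP=> v; rewrite inE => /andP[vI vA].
have /forall_inPn[[u w] uwX]: ~~ [forall p in X, ~~ ((p.1 \in v |: I) && (p.2 \in v |: I))].
  apply: contra vI => indvI; rewrite -(maxI (v |: I)) ?setU11 ?subsetUr //.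
  by rewrite /indep indvI subUset sub1set vA sIA.
have sI w' : w' \in I -> w' \in A by apply/subsetP.
have := indI _ uwX; rewrite negbK !inE /=; have [uI | uI] := boolP (u \in I).
  rewrite orbT /= => wI; rewrite (negPf wI) orbF => /eqP wv; subst w.
  apply/imsetP; exists (u, v); last by rewrite /g /= uI.
  by rewrite !inE /= uwX uI vA (sI u uI) ?andbF.
rewrite orbF /= => _ /andP[/eqP uv]; subst u.
have [/eqP wv | _ /= wI] := boolP (w == v); first by rewrite wv (negPf (X_irr v)) in uwX.
apply/imsetP; exists (v, w); last by rewrite /g /= (negPf vI).
by rewrite !inE /= uwX wI vA (sI w wI) ?andbF.
Qed.

(** * Bicoloured chords of a word and their pages *)

Definition chord := (nat * nat)%type.

Definition bicolored (s : seq bool) (i j : nat) := nth false s i != nth false s j.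

Definition chord_of (s : seq bool) (e : chord) :=
  [&& e.1 < e.2, e.2 < size s & bicolored s e.1 e.2].

Definition chord_cross (e f : chord) := [&& e.1 < f.1, f.1 < e.2 & e.2 < f.2].

Definition pageable k (s : seq bool) :=
  exists2 c : chord -> nat,
    forall e, chord_of s e -> c e < k &
    forall e f, chord_of s e -> chord_of s f -> chord_cross e f -> c e <> c f.

Lemma subseq_embedding (T : eqType) (x0 : T) (t s : seq T) : subseq t s ->
  exists2 h : nat -> nat, {homo h : i j / i < j} &
    forall i, i < size t -> h i < size s /\ nth x0 s (h i) = nth x0 t i.
Proof.
elim: s t => [|x s IHs] [|y t] //=; try by exists id.
have [-> | _] := eqVneq y x => /IHs[h h_mono hP]; last first.
  exists (fun i => (h i).+1) => [i j lt_ij | i /hP//]; by rewrite ltnS h_mono.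
exists (fun i => if i is i'.+1 then (h i').+1 else 0).
  by case=> [|i] [|j] //= lt_ij; rewrite ltnS h_mono.
by case=> [|i] //=; rewrite ltnS => /hP.
Qed.

(** An order-preserving embedding sends chords to chords and crossings to crossings, so page
    assignments pull back; hence blocking a subword suffices. *)
Lemma pageable_subseq k t s : subseq t s -> pageable k s -> pageable k t.
Proof.
move=> /(subseq_embedding false)[h h_mono hP] [c c_lt c_cross].
have h_chord e : chord_of t e -> chord_of s (h e.1, h e.2).
  case: e => i j /and3P[/= lt_ij lt_j bic]; have [lt_hj eq_j] := hP j lt_j.
  have [_ eq_i] := hP i (ltn_trans lt_ij lt_j).
  by rewrite /chord_of /= h_mono // lt_hj /bicolored eq_i eq_j.
exists (fun e => c (h e.1, h e.2)) => [e /h_chord/c_lt // | e f Pe Pf].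
move=> /and3P[? ? ?]; apply: c_cross; try exact: h_chord.
by rewrite /chord_cross /= !h_mono.
Qed.

(** * Dynamic programming for noncrossing subfamilies *)

(** One max-plus update: once the value [f] of [(i, k)] is known, the split at [k] competes, for
    every later [j] at once, with the splits already in [V]; [R] is the row of [k]. *)
Definition relax f (V R : seq nat) := [seq maxn vr.1 (f + vr.2) | vr <- zip V R].

(* [V] holds, for each [j >= k], the best sum of entries [(i, k')] and [(k', j)]
   over [i < k' < k]; [Rs] holds the rows of [k], [k.+1], ... *)
Fixpoint fan (Ei : seq nat) k (V : seq nat) (Rs : seq (seq nat)) : seq nat :=
  match V, Rs with
  | v :: V', R :: Rs' =>
    let f := v + count_mem k Ei in f :: fan Ei k.+1 (relax f V' R) Rs'
  | _, _ => [::]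
  end.

Definition out_ends (E : seq chord) i := [seq e.2 | e <- E & e.1 == i].

(* Row [i] lists, for [j = i.+1, i.+2, ...], the largest number of pairwise
   noncrossing members of the multiset [E] of chords between [i] and [j]. *)
Fixpoint table (E : seq chord) i N : seq (seq nat) :=
  if N is N'.+1 then
    let Rs := table E i.+1 N' in fan (out_ends E i) i.+1 (nseq N' 0) Rs :: Rs
  else [::].

Definition alpha E N := last 0 (head [::] (table E 0 N)).

Lemma size_relax f V R : size V = size R -> size (relax f V R) = size V.
Proof. by move=> eqs; rewrite size_map size_zip -eqs minnn. Qed.

Lemma nth_relax f V R t : size V = size R -> t < size V ->
  nth 0 (relax f V R) t = maxn (nth 0 V t) (f + nth 0 R t).
Proof.
by move=> eqs lt_t; rewrite (nth_map (0, 0)) ?nth_zip // size_zip -eqs minnn.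
Qed.

Definition staircase (Rs : seq (seq nat)) :=
  forall t, t < size Rs -> size (nth [::] Rs t) = (size Rs - t).-1.

(** The table has to dominate noncrossing families, so the recursion is recorded as lower bounds on
    its entries: one from the initial values, one for each split point. *)
Lemma fanP Ei k V Rs : size V = size Rs -> staircase Rs ->
  [/\ size (fan Ei k V Rs) = size V,
      forall t, t < size V ->
        nth 0 V t + count_mem (k + t) Ei <= nth 0 (fan Ei k V Rs) t
    & forall u t, u < t -> t < size V ->
        nth 0 (fan Ei k V Rs) u + nth 0 (nth [::] Rs u) (t - u.+1) + count_mem (k + t) Ei
          <= nth 0 (fan Ei k V Rs) t].
Proof.
elim: Rs k V => [|R Rs IHRs] k [|v V] //= [eqs] stairs.
have eqR: size V = size R by rewrite (stairs 0) // subn0.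
have stairs': staircase Rs by move=> t lt_t; rewrite (stairs t.+1).
set f := v + _; have [] := IHRs k.+1 (relax f V R) _ stairs'; rewrite size_relax //.
set G := fan _ _ _ _ => szG G1 G2; split=> /= [|[|t] lt_t|[|u] [|t] // lt_ut lt_t].
- by rewrite szG.
- by rewrite addn0.
- by rewrite -addSnnS (leq_trans _ (G1 t lt_t)) // leq_add2r nth_relax // leq_maxl.
- rewrite -addSnnS (leq_trans _ (G1 t lt_t)) // leq_add2r nth_relax //.
  by rewrite subSS subn0 leq_maxr.
- by rewrite -addSnnS; apply: G2.
Qed.

Lemma table_staircase E i N : size (table E i N) = N /\ staircase (table E i N).
Proof.
elim: N i => [|N IHN] i //=; have [szR stR] := IHN i.+1.
split=> [|[|t] lt_t]; rewrite /= ?szR //; last by rewrite -{2}szR stR.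
by have [-> _ _] := fanP (out_ends E i) i.+1 (etrans (size_nseq N 0) (esym szR)) stR;
   rewrite size_nseq ?subn0.
Qed.

Definition entry E N i j := nth 0 (head [::] (table E i (N - i))) (j - i.+1).

Lemma head_table E i N t : t < N ->
  nth [::] (table E i N) t = head [::] (table E (i + t) (N - t)).
Proof.
elim: N i t => // N IHN i [|t] lt_t; first by rewrite addn0.
by rewrite [LHS]/= IHN // addSnnS.
Qed.

Lemma count_out_ends E i j : count_mem j (out_ends E i) = count_mem (i, j) E.
Proof.
rewrite count_map count_filter; apply: eq_count => -[a b] /=.
by rewrite xpair_eqE andbC.
Qed.

Lemma entry_ge E N i j : i < j < N -> count_mem (i, j) E <= entry E N i j.
Proof.
case/andP=> lt_ij lt_jN; rewrite /entry.
have ->: N - i = (N - i.+1).+1 by lia.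
have [szR stR] := table_staircase E i.+1 (N - i.+1).
have [_ G1 _] := fanP (out_ends E i) i.+1 (etrans (size_nseq _ 0) (esym szR)) stR.
have /G1 : j - i.+1 < size (nseq (N - i.+1) 0) by rewrite size_nseq; lia.
by rewrite subnKC // count_out_ends; apply: leq_trans; apply: leq_addl.
Qed.

Lemma entry_split E N i k j : i < k -> k < j -> j < N ->
  entry E N i k + entry E N k j + count_mem (i, j) E <= entry E N i j.
Proof.
move=> lt_ik lt_kj lt_jN; rewrite {1 3}/entry.
have ->: N - i = (N - i.+1).+1 by lia.
have [szR stR] := table_staircase E i.+1 (N - i.+1).
have [_ _ G2] := fanP (out_ends E i) i.+1 (etrans (size_nseq _ 0) (esym szR)) stR.
have := G2 (k - i.+1) (j - i.+1); rewrite size_nseq subnKC ?count_out_ends; last by lia.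
rewrite head_table; last by lia.
rewrite subnKC // /entry (_ : N - i.+1 - _ = N - k); last by lia.
rewrite (_ : j - i.+1 - (k - i.+1).+1 = j - k.+1); last by lia.
by apply; lia.
Qed.

Definition inside i j (e : chord) := (i <= e.1) && (e.2 <= j).

(* In a noncrossing family the longest chord leaving [i] other than the base
   [(i, j)] ends at a point that no chord but the base passes over. *)
Lemma noncrossing_split (L : seq chord) i j : i.+1 < j ->
    {in L &, forall e f, ~~ chord_cross e f} ->
  exists2 k, i < k < j &
    {in L, forall e, inside i j e -> [|| e == (i, j), inside i k e | inside k j e]}.
Proof.
move=> lt_ij ncL.
(* The disjunct [k == i.+1] makes [P] inhabited when no chord other than the base leaves [i] inside
   the interval; then nothing starts strictly between [i] and [k]. *)
pose P k := (k == i.+1) || [&& k < j, i < k & (i, k) \in L].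
have exP: exists k, P k by exists i.+1; rewrite /P eqxx.
have leP k : P k -> k <= j by case/orP=> [/eqP-> | /and3P[/ltnW]] //; apply: ltnW.
case: (ex_maxnP exP leP) => k Pk maxk; exists k.
  by case/orP: Pk => [/eqP-> | /and3P[-> -> //]]; rewrite ltnSn.
move=> [a b] Lab; rewrite /inside xpair_eqE /= => /andP[le_ia le_bj].
have [/= le_bk | lt_kb] := leqP b k; first by rewrite le_ia !orbT.
have [le_ka | lt_ak] := leqP k a; first by rewrite le_bj !orbT.
rewrite ?andbF ?orbF; move: le_ia; rewrite leq_eqVlt => /orP[/eqP eq_ia | lt_ia].
  subst a; rewrite eqxx ?orbF /=; apply/idPn => neq_bj.
  have /maxk: P b by rewrite /P Lab ltn_neqAle neq_bj le_bj (ltn_trans _ lt_kb) ?orbT.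
  by rewrite leqNgt lt_kb.
case/orP: Pk => [/eqP eq_k | /and3P[_ lt_ik Lik]]; first by move: lt_ak; rewrite eq_k ltnNge lt_ia.
by have := ncL _ _ Lik Lab; rewrite /chord_cross /= lt_ia lt_ak lt_kb.
Qed.

Lemma count_sub_in (T : eqType) (a b : pred T) (s : seq T) :
  {in s, forall x, a x -> b x} -> count a s <= count b s.
Proof.
move=> ab; rewrite (@eq_in_count _ a (predI a b)) => [|x /ab /=].
  by apply: sub_count => x /andP[].
by case: (a x) => // ->.
Qed.

(** Induction on [j - i]: [noncrossing_split] leaves the base chord and two shorter intervals,
    matching the three terms of [entry_split]. *)
Lemma count_inside E L N i j : i < j < N ->
    {in L, forall e, e.1 < e.2} ->
    {in L &, forall e f, ~~ chord_cross e f} ->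
    (forall e, count_mem e L <= count_mem e E) ->
  count (inside i j) L <= entry E N i j.
Proof.
move=> + L_lt ncL leLE; have [d] := ubnP (j - i).
elim: d i j => // d IHd i j le_d lt_ijN; have /andP[lt_ij lt_jN] := lt_ijN.
have le_split (a b c : pred chord) : {in L, forall e, a e -> b e || c e} ->
    count a L <= count b L + count c L.
  move=> abc; apply: leq_trans (_ : count (predU b c) L <= _).
    by apply: count_sub_in.
  by rewrite -count_predUI leq_addr.
have [lt_Sij | le_jSi] := ltnP i.+1 j; last first.
  apply: leq_trans (entry_ge E lt_ijN); apply: leq_trans (leLE _).
  apply: count_sub_in => -[a b] /L_lt /= lt_ab /andP[/= le_ia le_bj].
  by rewrite xpair_eqE; lia.
have [k /andP[lt_ik lt_kj] splitk] := noncrossing_split lt_Sij ncL.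
apply: leq_trans (entry_split E lt_ik lt_kj lt_jN); rewrite addnC.
apply: leq_trans (le_split _ (pred1 (i, j)) (predU (inside i k) (inside k j)) splitk) _.
apply: leq_add (leLE _) _.
apply: leq_trans (le_split _ (inside i k) (inside k j) _) _ => //.
by apply: leq_add; apply: IHd; lia.
Qed.

Lemma alphaE E N : 1 < N -> alpha E N = entry E N 0 N.-1.
Proof.
move=> lt_1N; rewrite /alpha /entry subn0 subn1 -nth_last; congr nth.
have [szR stR] := table_staircase E 0 N.
by rewrite -nth0 stR szR ?subn0 // ltnW.
Qed.

(** * Blocking multisets and the covering of all words *)

Lemma sum_count_eq (T : Type) (c : T -> nat) k (E : seq T) :
  all (fun e => c e < k) E -> \sum_(p < k) count (fun e => c e == p) E = size E.
Proof.
elim: E => [_ | e E IHE /= /andP[lt_ck /IHE <-]]; first by rewrite big1.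
rewrite big_split /= -add1n (bigD1 (Ordinal lt_ck)) //= eqxx big1 // => p neq_p.
by apply/eqP; rewrite eqb0 eq_sym; apply: contra neq_p => /eqP eqp; apply/eqP/val_inj.
Qed.

Definition blocks k (c : seq bool * seq chord) :=
  all (chord_of c.1) c.2 && (k * alpha c.2 (size c.1) < size c.2).

(** Pigeonhole: the chords on one page form a noncrossing subfamily, of size at most [alpha], so k
    pages hold at most k times as many. *)
Lemma blocksP k (c : seq bool * seq chord) : blocks k c -> ~ pageable k c.1.
Proof.
case: c => s E /andP[/= /allP chE ltE] [c c_lt c_cross].
have N_gt1: 1 < size s.
  case: E chE ltE => [|e E] chE; first by rewrite ltn0.
  by have /and3P[? ? _] := chE e (mem_head _ _); lia.
rewrite ltnNge in ltE; case/negP: ltE.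
rewrite -(@sum_count_eq _ c k); last by apply/allP=> e /chE/c_lt.
rewrite -[X in _ <= X * _](card_ord k) -sum_nat_const; apply: leq_sum => p _.
pose L := [seq e <- E | c e == p].
have Lch e : e \in L -> chord_of s e by rewrite mem_filter => /andP[_ /chE].
rewrite alphaE //; apply: leq_trans (count_inside (L := L) _ _ _ _).
- rewrite -size_filter -/L -(count_predT L).
  by apply: count_sub_in => e /Lch/and3P[? ? _] _; rewrite /inside; lia.
- lia.
- by move=> e /Lch/and3P[].
- move=> e f; rewrite !mem_filter => /andP[/eqP ce eE] /andP[/eqP cf fE].
  by apply/negP=> /(c_cross e f (chE e eE) (chE f fE)); rewrite ce cf.
- by move=> e; rewrite count_filter sub_count // => x /andP[].
Qed.

(* Words of [ds] are matched greedily from the left; those with more letters [x]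
   than the [n] occurrences of [x] still to come are dropped. *)
Fixpoint advance (x : bool) n (ds : seq (seq bool)) : seq (seq bool) :=
  match ds with
  | (y :: d) :: ds' =>
    if x == y then d :: advance x n ds'
    else if count_mem x d <= n then (y :: d) :: advance x n ds' else advance x n ds'
  | _ => [::]
  end.

(* Nested conditionals, because [||] and [&&] are strict under [vm_compute]. *)
Fixpoint covered N r b ds :=
  if has (fun d : seq bool => nilp d) ds then true else
  if N isn't N'.+1 then false else
  if (if r is r'.+1 then covered N' r' b (advance true r' ds) else true) then
    if b is b'.+1 then covered N' r b' (advance false b' ds) else true
  else false.

Lemma advance_subseq x n ds s :
  has (subseq^~ s) (advance x n ds) -> has (subseq^~ (x :: s)) ds.
Proof.
elim: ds => [|[|y d] ds IHds] //=.
have [_ | _] := eqVneq x y; first by case/orP=> [-> // | /IHds->]; rewrite orbT.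
by case: ifP => _ /=; first case/orP=> [-> //|]; move=> /IHds->; rewrite orbT.
Qed.

(** The search runs through the tree of words with [r] letters [true] and [b] letters [false]; a
    branch closes once some candidate is used up. *)
Lemma coveredP N r b ds s : covered N r b ds -> size s = N ->
  count_mem true s = r -> count_mem false s = b -> has (subseq^~ s) ds.
Proof.
elim: N r b ds s => [|N IHN] r b ds s /=; case: ifP => [/hasP[d d_ds /nilP d0] _ _ _ _ | _ //].
- by apply/hasP; exists d; rewrite // d0 sub0seq.
- by apply/hasP; exists d; rewrite // d0 sub0seq.
case: ifP => // cov_r cov_b; case: s => //= -[] s [sz_s]; rewrite /= ?add0n add1n.
  by move=> r_s b_s; rewrite -r_s in cov_r; apply: advance_subseq (IHN _ _ _ _ cov_r _ _ _).
by move=> r_s b_s; rewrite -b_s in cov_b; apply: advance_subseq (IHN _ _ _ _ cov_b _ _ _).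
Qed.

(** * From a drawing to its colour word *)

Section DrawingWord.

Variables (k m n : nat) (D : book_drawing k m n).
Variables (B : {set 'I_n}) (e0 : Kedge m n).

Let is_red (u : Kvert m n) := if u is inl _ then true else false.

Definition spine : seq (Kvert m n) :=
  sort (relpre (bd_pos D) leq) ([seq inl i | i <- enum 'I_m] ++ [seq inr j | j <- enum B]).

Definition spine_word := [seq is_red u | u <- spine].

(** The last branch is a default, reached only for two vertices of the same colour, hence never on a
    chord of the word. *)
Let edge_between (u v : Kvert m n) : Kedge m n :=
  match u, v with
  | inl i, inr j | inr j, inl i => (i, j)
  | _, _ => e0
  end.

Let vertex i := nth (inl e0.1) spine i.

Lemma count_spine_word : count_mem true spine_word = m /\ count_mem false spine_word = #|B|.
Proof.
have perm_spine : perm_eq spine ([seq inl i | i <- enum 'I_m] ++ [seq inr j | j <- enum B]).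
  by rewrite perm_sort.
split; rewrite count_map (permP perm_spine) count_cat (count_map inl) (count_map inr).
  rewrite (@eq_count _ _ predT) // count_predT size_enum_ord.
  by rewrite (@eq_count _ _ pred0) // count_pred0 addn0.
rewrite (@eq_count _ _ pred0) // count_pred0.
by rewrite (@eq_count _ _ predT) // count_predT cardE.
Qed.

Lemma spine_lt i j : i < j -> j < size spine -> bd_pos D (vertex i) < bd_pos D (vertex j).
Proof.
move=> lt_ij lt_j; have lt_i := ltn_trans lt_ij lt_j.
rewrite /vertex -(nth_map _ 0 _ lt_i) -(nth_map _ 0 _ lt_j).
apply: (sorted_ltn_nth ltn_trans) lt_ij; rewrite ?inE ?size_map //.
rewrite ltn_sorted_uniq_leq (map_inj_uniq (@bd_pos_inj _ _ _ D)).
rewrite sorted_map sort_sorted ?andbT => [|u v]; last exact: leq_total.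
rewrite sort_uniq cat_uniq (map_inj_uniq inl_inj).
rewrite (map_inj_uniq inr_inj) !enum_uniq andbT /=.
by apply/hasPn=> _ /mapP[j' _ ->]; apply/negP=> /mapP[].
Qed.

Lemma vertex_blue i j' : i < size spine -> vertex i = inr j' -> j' \in B.
Proof.
move=> lt_i eq_i; have := mem_nth (inl e0.1) lt_i; rewrite -/(vertex i) eq_i.
rewrite mem_sort mem_cat => /orP[/mapP[] // | /mapP[j'' + [->]]].
by rewrite mem_enum.
Qed.

Lemma spine_chord e (f := edge_between (vertex e.1) (vertex e.2)) :
    chord_of spine_word e ->
  [/\ f.2 \in B, left_end D f = bd_pos D (vertex e.1)
    & right_end D f = bd_pos D (vertex e.2)].
Proof.
case: e @f => i j /= /and3P[/= lt_ij]; rewrite size_map => lt_j.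
have lt_i := ltn_trans lt_ij lt_j; have := spine_lt lt_ij lt_j.
have := @vertex_blue i; have := @vertex_blue j.
rewrite /bicolored !(nth_map (inl e0.1)) // -!/(vertex _) /left_end /right_end.
case: (vertex i) (vertex j) => [a|a] [b|b] //= Bb Ba lt_ab _; split; try lia.
- exact: Bb.
- exact: Ba.
Qed.

Lemma drawing_pageable :
    (forall e f, e.2 \in B -> f.2 \in B -> ~~ crossing_pair D e f) ->
  pageable k spine_word.
Proof.
move=> ncB; exists (fun e => bd_page D (edge_between (vertex e.1) (vertex e.2))) => // e f.
move=> /[dup] /and3P[_ lt_e _] /spine_chord[Be le re] /[dup] /and3P[_ lt_f _].
rewrite size_map in lt_e lt_f => /spine_chord[Bf lf rf].
move=> /and3P[lt1 lt2 lt3] /val_inj eq_page.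
have /negP[] := ncB _ _ Be Bf; rewrite /crossing_pair eq_page eqxx le re lf rf.
by rewrite !spine_lt // (ltn_trans lt2).
Qed.

End DrawingWord.

(** * Upper bound: clones in a plane drawing *)

Definition interleaved x y u v :=
  [&& minn x y < minn u v, minn u v < maxn x y & maxn x y < maxn u v].

Lemma ltn_lex n x y u v : u < n -> v < n -> x != y ->
  (x * n + u < y * n + v) = (x < y).
Proof.
move=> lt_u lt_v; case: (ltngtP x y) => // lt_xy _; have := leq_mul lt_xy (leqnn n);
  rewrite mulSn; lia.
Qed.

(** Clones [p], [q] lie on the same side of each of the red points [x], [y]. Once one matching
    between them interleaves, neither its reversal nor the other matching in either order does, so a
    repeated page costs one crossing. *)
Lemma interleaved_swap x y p q :
    (x < p) = (x < q) -> (p < x) = (q < x) -> (y < p) = (y < q) -> (p < y) = (q < y) ->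
  [/\ interleaved x p y q -> ~~ interleaved x q y p,
      interleaved x p y q -> ~~ interleaved y p x q
    & interleaved x p y q -> ~~ interleaved y q x p].
Proof.
rewrite /interleaved /minn /maxn.
case: (ltngtP x p) => ?; case: (ltngtP x q) => ? // _ _;
  case: (ltngtP y p) => ?; case: (ltngtP y q) => ? // _ _; split; lia.
Qed.

(** Turns the floor sum into a set of pairs, the target of the injection [blue_pair]. *)
Lemma card_lt_divn n l :
  #|[set p : 'I_n * 'I_n | p.2 < p.1 %/ l]| = \sum_(0 <= w < n) w %/ l.
Proof.
rewrite big_mkord (eq_bigr (fun w : 'I_n => \sum_(i < n | i < w %/ l) 1)) => [|w _].
  by rewrite pair_big_dep /= -sum1_card; apply: eq_bigl => p; rewrite inE.
have le_wn : w %/ l <= n by rewrite (leq_trans (leq_div w l)) 1?ltnW.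
by rewrite (big_ord_narrow le_wn) sum1_card card_ord.
Qed.

Section Clones.

Variables (k m l n : nat) (rp bp : nat -> nat) (pg : nat -> nat -> nat).
Hypotheses (l_gt0 : 0 < l) (n_gt0 : 0 < n) (pg_lt : forall a j, pg a j < k).
Hypothesis rp_inj : forall a b, a < m -> b < m -> rp a = rp b -> a = b.
Hypothesis bp_inj : forall i j, i < l -> j < l -> bp i = bp j -> i = j.
Hypothesis rp_bp : forall a j, a < m -> j < l -> rp a != bp j.
Hypothesis planar : forall a b i j, a < m -> b < m -> i < l -> j < l -> i != j ->
  pg a i = pg b j -> ~~ interleaved (rp a) (bp i) (rp b) (bp j).
Hypothesis one_repeat : forall j a b a' b', j < l -> a < b -> b < m -> a' < b' -> b' < m ->
  pg a j = pg b j -> pg a' j = pg b' j -> a = a' /\ b = b'.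

(* Blue vertices in the same residue class modulo [l] sit side by side. *)
Definition clone_pos (u : Kvert m n) : nat :=
  match u with inl r => rp r * n + 0 | inr v => bp (v %% l) * n + v %/ l end.

Lemma quo_lt (v : 'I_n) : v %/ l < n.
Proof. exact: leq_ltn_trans (leq_div v l) (ltn_ord v). Qed.

Lemma eq_lex x y u v : u < n -> v < n -> x * n + u = y * n + v -> x = y /\ u = v.
Proof.
move=> lt_u lt_v eq_xy; have [eqxy | neq_xy] := eqVneq x y.
  by split=> //; move: eq_xy; rewrite eqxy => /addnI.
have := ltn_lex lt_u lt_v neq_xy; rewrite eq_sym in neq_xy.
by have := ltn_lex lt_v lt_u neq_xy; lia.
Qed.

Lemma clone_pos_inj : injective clone_pos.
Proof.
have mod_l (v : 'I_n) : v %% l < l by rewrite ltn_mod.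
case=> [a|v] [b|w] /= eq_p.
- have [eq_ab _] := eq_lex n_gt0 n_gt0 eq_p.
  by congr inl; apply/val_inj/(rp_inj _ _ eq_ab).
- have [/eqP] := eq_lex n_gt0 (quo_lt w) eq_p.
  by rewrite (negPf (rp_bp _ _)).
- have [/esym/eqP] := eq_lex (quo_lt v) n_gt0 eq_p.
  by rewrite (negPf (rp_bp _ _)).
- have [eq_b eq_q] := eq_lex (quo_lt v) (quo_lt w) eq_p.
  congr inr; apply/val_inj; rewrite /= (divn_eq v l) (divn_eq w l) eq_q.
  by rewrite (bp_inj _ _ eq_b).
Qed.

Definition clone_drawing : book_drawing k m n :=
  @BookDrawing k m n clone_pos clone_pos_inj
    (fun e => Ordinal (pg_lt e.1 (e.2 %% l))).

(** Scaling by [n] keeps the order of distinct base points, so a crossing between different residues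
    would already occur in the base drawing, against [planar]. *)
Lemma clone_crossing (e f : Kedge m n) : crossing_pair clone_drawing e f ->
  [/\ e.1 != f.1, e.2 != f.2, e.2 %% l = f.2 %% l & pg e.1 (e.2 %% l) = pg f.1 (f.2 %% l)].
Proof.
case: e f => [a v] [b w]; rewrite /crossing_pair /left_end /right_end /= -val_eqE /=.
case/andP=> /eqP eq_pg cross.
have neq_ab : a != b by apply: contraTneq cross => ->; lia.
have neq_vw : v != w by apply: contraTneq cross => ->; lia.
split=> //; apply/eqP; apply: contraTT (cross) => neq_mod.
have mod_l (u : 'I_n) : u %% l < l by rewrite ltn_mod.
have := planar (ltn_ord a) (ltn_ord b) (mod_l v) (mod_l w) neq_mod eq_pg.
have neq_rp: rp a != rp b.
  by apply: contra neq_ab => /eqP eq_ab; apply/eqP/val_inj/(rp_inj _ _ eq_ab).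
have neq_bp: bp (v %% l) != bp (w %% l).
  by apply: contra neq_mod => /eqP eq_vw; apply/eqP/bp_inj.
have neq_rb (r : 'I_m) (u : 'I_n) := rp_bp (ltn_ord r) (mod_l u).
have neq_br (r : 'I_m) (u : 'I_n) : bp (u %% l) != rp r by rewrite eq_sym neq_rb.
have [neq_rp' neq_bp'] : rp b != rp a /\ bp (w %% l) != bp (v %% l).
  by split; rewrite eq_sym.
rewrite /interleaved /minn /maxn !(ltn_lex n_gt0 (quo_lt _)) //.
by case: ifP; case: ifP; rewrite !ltn_lex ?quo_lt ?n_gt0.
Qed.

Lemma same_repeat j a b a' b' : j < l -> a < m -> b < m -> a' < m -> b' < m ->
    a != b -> a' != b' -> pg a j = pg b j -> pg a' j = pg b' j ->
  a = a' /\ b = b' \/ a = b' /\ b = a'.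
Proof.
move=> lt_j lt_a lt_b lt_a' lt_b'.
case: (ltngtP a b) => // lt_ab _; case: (ltngtP a' b') => // lt_ab' _ eq_ab eq_ab'.
- by left; apply: one_repeat eq_ab eq_ab'.
- by right; apply: one_repeat eq_ab (esym eq_ab').
- by right; case: (one_repeat lt_j lt_ab lt_a lt_ab' lt_b' (esym eq_ab) eq_ab').
- by left; case: (one_repeat lt_j lt_ab lt_a lt_ab' lt_a' (esym eq_ab) (esym eq_ab')).
Qed.

(** The blue ends of a crossing share their residue modulo [l], so the larger one and the quotient
    of the smaller determine the unordered pair. *)
Definition blue_pair (p : Kedge m n * Kedge m n) : 'I_n * 'I_n :=
  let: (v, w) := (p.1.2, p.2.2) in
  if v < w then (w, Ordinal (quo_lt v)) else (v, Ordinal (quo_lt w)).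

(** The unordered pair of clones fixes the two red vertices up to order by [one_repeat]; of the four
    ordered pairs of edges left, [interleaved_swap] allows one. *)
Lemma blue_pair_inj :
  {in [set p | crossing_pair clone_drawing p.1 p.2] &, injective blue_pair}.
Proof.
have mod_l (u : 'I_n) : u %% l < l by rewrite ltn_mod.
case=> -[a v] [b w] [[a' v'] [b' w']]; rewrite !inE /= => cr cr'.
have [/= neq_ab neq_vw eq_vw rep] := clone_crossing cr.
have [/= neq_ab' neq_vw' eq_vw' rep'] := clone_crossing cr'.
have eq_ord (u u' : 'I_n) : u %% l = u' %% l -> u %/ l = u' %/ l -> u = u'.
  by move=> eq_r eq_q; apply/val_inj; rewrite /= (divn_eq u l) (divn_eq u' l) eq_q eq_r.
have eq_blue : blue_pair ((a, v), (b, w)) = blue_pair ((a', v'), (b', w')) ->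
    v = v' /\ w = w' \/ v = w' /\ w = v'.
  rewrite /blue_pair /=; case: ifP => _; case: ifP => _ [].
  - by move=> eq_w eq_q; left; split=> //; apply: eq_ord => //; rewrite eq_vw eq_vw' eq_w.
  - by move=> eq_w eq_q; right; split=> //; apply: eq_ord => //; rewrite eq_vw eq_w.
  - by move=> eq_v eq_q; right; split=> //; apply: eq_ord => //; rewrite -eq_vw eq_v.
  - by move=> eq_v eq_q; left; split=> //; apply: eq_ord => //; rewrite -eq_vw -eq_vw' eq_v.
move=> /eq_blue {}eq_blue.
rewrite -eq_vw in rep; rewrite -eq_vw' in rep'.
have eq_vv' : v %% l = v' %% l by case: eq_blue => -[-> ?] //; rewrite -eq_vw'.
rewrite -eq_vv' in rep'.
have eq_red : a = a' /\ b = b' \/ a = b' /\ b = a'.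
  have := same_repeat (mod_l v) (ltn_ord a) (ltn_ord b) (ltn_ord a') (ltn_ord b').
  by case/(_ neq_ab neq_ab' rep rep') => -[/val_inj-> /val_inj->]; [left | right].
have side (r : 'I_m) : let x := rp r * n + 0 in
    let p := bp (v %% l) * n + v %/ l in let q := bp (v %% l) * n + w %/ l in
    (x < p) = (x < q) /\ (p < x) = (q < x).
  have neq := rp_bp (ltn_ord r) (mod_l v); have neq' := neq; rewrite eq_sym in neq'.
  by rewrite /= !ltn_lex ?quo_lt ?n_gt0.
have [/= a_p a_q] := side a; have [/= b_p b_q] := side b.
have [not_wv not_vv not_ww] := interleaved_swap a_p a_q b_p b_q; move: cr cr'.
rewrite /crossing_pair /left_end /right_end /= => /andP[_ cr] /andP[_ cr'].
rewrite -eq_vw -/(interleaved _ _ _ _) in cr.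
rewrite -eq_vw' -eq_vv' -/(interleaved _ _ _ _) in cr'.
case: eq_red eq_blue cr' => -[<- <-] [] [<- <-] // cr'.
- by have := not_wv cr; rewrite cr'.
- by have := not_vv cr; rewrite cr'.
- by have := not_ww cr; rewrite cr'.
Qed.

Lemma crossings_clone : crossings clone_drawing <= \sum_(0 <= i < n) i %/ l.
Proof.
rewrite -card_lt_divn /crossings -(card_in_imset blue_pair_inj); apply: subset_leq_card.
apply/subsetP=> _ /imsetP[[[a v] [b w]] + ->]; rewrite !inE /blue_pair /=.
move=> /clone_crossing[_ /= neq_vw eq_vw _].
have := divn_eq v l; have := divn_eq w l; rewrite eq_vw.
have : nat_of_ord v != w by [].
by case: ifP => lt_vw /=; nia.
Qed.

End Clones.

(* The first [uphalf m] red vertices are each followed by a block of [m./2] blue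
   ones.  Along the red vertices the page of a blue vertex increases cyclically by
   one, pausing once, at a step that moves with the index inside the block; the last
   vertex of a block does not pause, and its last page equals its first. *)
Definition red_pos m r := r + m./2 * minn r (uphalf m).
Definition blue_pos m j := j + j %/ m./2 + 1.
Definition page_of m r j := (j %/ m./2 + r - (uphalf m + j %% m./2 < r)) %% m.-1.

Definition planar_check m l :=
  [&& uniq (map (red_pos m) (iota 0 m) ++ map (blue_pos m) (iota 0 l)),
      all (fun a => all (fun i => all (fun b => all (fun j =>
        (i != j) && (page_of m a i == page_of m b j) ==>
          ~~ interleaved (red_pos m a) (blue_pos m i) (red_pos m b) (blue_pos m j))
        (iota 0 l)) (iota 0 m)) (iota 0 l)) (iota 0 m)
    & all (fun j => size [seq p <- [seq (a, b) | a <- iota 0 m, b <- iota 0 m]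
                         | (p.1 < p.2) && (page_of m p.1 j == page_of m p.2 j)] <= 1)
        (iota 0 l)].

Lemma drawing_with_clones m l n : 1 < m -> 0 < l -> 0 < n -> planar_check m l ->
  exists D : book_drawing m.-1 m n, crossings D <= \sum_(0 <= i < n) i %/ l.
Proof.
move=> m_gt1 l_gt0 n_gt0 /and3P[uniq_pos /allP planar /allP one_repeat].
have in_iota0 p q : p < q -> p \in iota 0 q by rewrite mem_iota.
have map_inj (f : nat -> nat) q : uniq (map f (iota 0 q)) ->
    forall i j, i < q -> j < q -> f i = f j -> i = j.
  move=> uf i j lt_i lt_j eq_f; apply/eqP.
  rewrite -(nth_uniq 0 _ _ uf) ?size_map ?size_iota //.
  by rewrite !(nth_map 0) ?size_iota // !nth_iota // !add0n eq_f.
have page_lt a j : page_of m a j < m.-1 by rewrite ltn_mod; lia.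
move: uniq_pos; rewrite cat_uniq => /and3P[/map_inj red_inj /hasPn red_blue /map_inj blue_inj].
have red_neq_blue a j : a < m -> j < l -> red_pos m a != blue_pos m j.
  move=> lt_a lt_j; apply: contraNneq (red_blue _ (map_f _ (in_iota0 _ _ lt_j))) => <-.
  exact/map_f/in_iota0.
have ncross a b i j : a < m -> b < m -> i < l -> j < l -> i != j ->
    page_of m a i = page_of m b j ->
  ~~ interleaved (red_pos m a) (blue_pos m i) (red_pos m b) (blue_pos m j).
  move=> lt_a lt_b lt_i lt_j neq_ij /eqP eq_pg.
  have /allP/(_ _ (in_iota0 _ _ lt_i))/allP := planar _ (in_iota0 _ _ lt_a).
  by move/(_ _ (in_iota0 _ _ lt_b))/allP/(_ _ (in_iota0 _ _ lt_j)); rewrite neq_ij eq_pg.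
have repeat_inj j a b a' b' : j < l -> a < b -> b < m -> a' < b' -> b' < m ->
    page_of m a j = page_of m b j -> page_of m a' j = page_of m b' j -> a = a' /\ b = b'.
  move=> /in_iota0/one_repeat + lt_ab lt_b lt_ab' lt_b' /eqP eq_pg /eqP eq_pg'.
  set s := filter _ _ => le_s1; suff [] : (a, b) = (a', b') by [].
  have s_ab : (a, b) \in s.
    rewrite mem_filter /= lt_ab eq_pg; apply/allpairsP; exists (a, b).
    by rewrite !in_iota0 // (ltn_trans lt_ab).
  have s_ab' : (a', b') \in s.
    rewrite mem_filter /= lt_ab' eq_pg'; apply/allpairsP; exists (a', b').
    by rewrite !in_iota0 // (ltn_trans lt_ab').
  case: s le_s1 s_ab s_ab' => [|p [|p' s]] //= _.
  by rewrite !inE => /eqP-> /eqP.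
by exists (clone_drawing l_gt0 n_gt0 page_lt red_inj blue_inj red_neq_blue);
   apply: crossings_clone ncross repeat_inj.
Qed.

(** * Lower bound from unpageable words *)

Lemma crossings_ge k m l n (D : book_drawing k m.+1 n) : 0 < l ->
    (forall s, count_mem true s = m.+1 -> count_mem false s = l.+1 -> ~ pageable k s) ->
  \sum_(0 <= i < n) i %/ l <= crossings D.
Proof.
move=> l_gt0 unpageable; pose cross := [set p | crossing_pair D p.1 p.2].
(* The conflict graph on blue vertices; several crossings may give one pair, so [X] has at most as
   many members as there are crossings. *)
pose X : {set 'I_n * 'I_n} := [set (p.1.2, p.2.2) | p in cross].
have X_irr v : (v, v) \notin X.
  apply/imsetP=> -[[[a v1] [b v2]]]; rewrite inE /crossing_pair /left_end /right_end /=.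
  by move=> /andP[_ cr] [eq1 eq2]; subst; lia.
have small_indep (I : {set 'I_n}) :
    {in X, forall p, ~~ ((p.1 \in I) && (p.2 \in I))} -> #|I| <= l.
  move=> indI; rewrite leqNgt; apply/negP=> lt_lI.
  have /card_gt0P[j0 _] : 0 < #|I| by apply: leq_trans lt_lI.
  (* Exactly [l.+1] points are kept because [unpageable] fixes the number of blue letters. *)
  pose B := [set j in take l.+1 (enum I)].
  have cardB : #|B| = l.+1.
    by rewrite cardsE (card_uniqP _) ?take_uniq ?enum_uniq // size_takel // -cardE.
  have sBI j : j \in B -> j \in I by rewrite inE => /mem_take; rewrite mem_enum.
  have [reds blues] := count_spine_word D B.
  apply: (unpageable (spine_word D B)) => //; first by rewrite blues.
  apply: (drawing_pageable (ord0, j0)) => e f Be Bf; apply/negP=> cr.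
  have /indI/negP[] : (e.2, f.2) \in X by apply/imsetP; exists (e, f); rewrite ?inE.
  by rewrite !sBI.
have := turan_edges l_gt0 X_irr small_indep setT; rewrite cardsT card_ord => /leq_trans-> //.
apply: leq_trans (leq_imset_card (fun p => (p.1.2, p.2.2)) cross).
by apply: subset_leq_card; apply/subsetP=> p; rewrite inE => /andP[].
Qed.

(** * Certificates and their verification *)

Definition word_of_gaps (g : seq nat) := flatten [seq true :: nseq x false | x <- g].

Definition obstruction := (seq bool * seq chord)%type.

Definition obstruction_of (o : seq nat * seq (seq nat)) : obstruction :=
  (word_of_gaps o.1,
   flatten [seq [seq (i, j) | j <- nth [::] o.2 i] | i <- iota 0 (size o.2)]).

Definition chord_map (f : nat -> nat) (e : chord) : chord :=
  (minn (f e.1) (f e.2), maxn (f e.1) (f e.2)).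

Definition rotation r (o : obstruction) : obstruction :=
  let N := size o.1 in
  (rotr r o.1, [seq chord_map (fun i => if i + r < N then i + r else i + r - N) e | e <- o.2]).

Definition reflection (o : obstruction) : obstruction :=
  (rev o.1, [seq chord_map (fun i => (size o.1).-1 - i) e | e <- o.2]).

(** Symmetries of the circle preserve crossings; each image is nevertheless certified afresh by
    [blocks]. *)
Definition dihedral_orbit (o : obstruction) :=
  flatten [seq [:: rotation r o; rotation r (reflection o)] | r <- iota 0 (size o.1)].

Fixpoint words m : seq (seq bool) :=
  if m is m'.+1 then map (cons true) (words m') ++ map (cons false) (words m') else [:: [::]].

(* In a word [u] followed by its complement, antipodal letters differ, so the
   antipodal chords are bicoloured and cross pairwise. *)
Definition antipodal (u : seq bool) : obstruction :=
  (u ++ map negb u, [seq (i, i + size u) | i <- iota 0 (size u)]).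

Definition obstructions m l :=
  map antipodal (words m) ++ flatten [seq dihedral_orbit (obstruction_of o) | o <- l].

Definition unpageable_check m b l :=
  let os := obstructions m l in
  all (blocks m.-1) os && covered (m + b) m b (undup (map fst os)).

Lemma unpageable_checkP m b l s : unpageable_check m b l ->
  count_mem true s = m -> count_mem false s = b -> ~ pageable m.-1 s.
Proof.
case/andP=> /allP all_block cov red_s blue_s pg_s.
have size_s : size s = m + b.
  rewrite -(count_predC (pred1 true)) red_s -blue_s; congr addn.
  by apply: eq_count => -[].
have /hasP[t] := coveredP cov size_s red_s blue_s.
rewrite mem_undup => /mapP[o /all_block/blocksP not_pg ->] sub_s.
exact/not_pg/(pageable_subseq sub_s).
Qed.

(* The pair [(d, rows)] stands for the word whose [i]-th red letter is followed by
   [d_i] blue ones, and for the multiset of chords [(i, j)], [j] in the [i]-th row.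
   The multiplicities are optimal weights of the linear program for the
   fractional number of pages, scaled to integers. *)
Definition fractional3 : seq (seq nat * seq (seq nat)) := [::
  ([:: 2; 1; 0],
   [:: [:: 2; 4]; [:: 3; 5]; [:: 5]])].

Definition fractional4 : seq (seq nat * seq (seq nat)) := [::
  ([:: 3; 1; 0; 0],
   [:: [:: 3; 5]; [:: 4; 6]; [:: 6; 7]; [:: 7]]);
  ([:: 3; 0; 2; 0],
   [:: [:: 2; 3; 6; 7]; [:: 4; 5; 8]; [:: 4; 5; 8]; [:: 5; 8]; [:: 6; 7]; [:: 7]; [:: 8]]);
  ([:: 2; 1; 1; 0],
   [:: [:: 2; 4; 6]; [:: 3; 5; 7]; [:: 5; 7]; [:: 6]; [:: 7]])].

Definition fractional5 : seq (seq nat * seq (seq nat)) := [::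
  ([:: 4; 1; 0; 0; 0],
   [:: [:: 4; 6]; [:: 5; 7]; [:: 7; 8]; [:: 8; 9]; [:: 9]]);
  ([:: 3; 1; 2; 0; 0],
   [:: [:: 3; 5; 8]; [:: 4; 6; 9]; [:: 6; 9; 10]; [:: 10]; [:: 8]; [:: 9]; [::]; [:: 10]]);
  ([:: 3; 1; 0; 3; 0],
   [:: [:: 3; 9]; [:: 4; 7]; [:: 6; 11]; [:: 7]; [:: 8; 10]; [:: 11]; [:: 9]; [:: 10]; [:: 11]]);
  ([:: 4; 0; 2; 1; 0],
   [:: [:: 4; 8]; [:: 5; 9]; [:: 6]; [:: 9; 11]; [::]; [::]; [:: 10]; [:: 11]]);
  ([:: 4; 0; 3; 0; 0],
   [:: [:: 3; 4; 7; 8; 9]; [:: 5; 5; 10]; [:: 6; 10; 11]; [:: 6; 10; 11]; [:: 11]; [:: 8; 9]; [:: 9]; [:: 10; 11]; [:: 11]]);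
  ([:: 2; 1; 1; 1; 0],
   [:: [:: 2; 4; 6; 8]; [:: 3; 5; 7; 9]; [:: 5; 7; 9]; [:: 6; 8]; [:: 7; 9]; [:: 8]; [:: 9]])].

Definition fractional6 : seq (seq nat * seq (seq nat)) := [::
  ([:: 5; 1; 0; 0; 0; 0],
   [:: [:: 5; 7]; [:: 6; 8]; [:: 8; 9]; [:: 9; 10]; [:: 10; 11]; [:: 11]]);
  ([:: 4; 0; 2; 0; 1; 0],
   [:: [:: 4; 8]; [:: 5; 9]; [:: 6; 10]; [:: 9; 12]; [:: 10]; [::]; [:: 11]; [:: 12]]);
  ([:: 3; 1; 1; 3; 0; 0],
   [:: [:: 3; 3; 5; 7; 9; 10; 11; 11]; [:: 4; 6; 8; 12; 12]; [:: 4; 6; 8; 12; 13; 13]; [:: 6; 8; 12; 13]; [:: 7; 9; 10; 11]; [:: 8; 12; 13]; [:: 9; 10; 11]; [:: 12; 13]; [:: 10; 11]; [:: 12; 12; 13]; [:: 13; 13]]);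
  ([:: 4; 2; 2; 0; 0; 0],
   [:: [:: 4; 7; 10]; [:: 5; 8; 11]; [:: 11; 12]; [:: 8; 12; 13]; [:: 13]; [:: 10]; [:: 11]; [:: 12]; [::]; [:: 13]]);
  ([:: 4; 0; 4; 0; 0; 0],
   [:: [:: 4; 8; 10]; [:: 5; 11]; [:: 6; 12]; [:: 11; 13]; [:: 12]; [:: 9]; [:: 10]; [:: 11; 13]; [:: 12]; [:: 13]]);
  ([:: 4; 1; 0; 4; 0; 0],
   [:: [:: 4; 6; 10; 11]; [:: 5; 7]; [:: 7; 8; 13]; [:: 8; 13; 14]; [:: 14]; [:: 10; 11]; [::]; [:: 11; 12]; [:: 12]; [:: 13; 14]; [:: 14]]);
  ([:: 5; 0; 1; 3; 0; 0],
   [:: [:: 5; 5; 11]; [:: 6; 6; 7]; [:: 7; 7; 9; 13]; [:: 9; 9; 13]; [:: 13; 14; 14]; [:: 14]; [:: 11]; [:: 12]; [:: 13]; [::]; [:: 14]]);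
  ([:: 5; 0; 0; 4; 0; 0],
   [:: [:: 5; 5; 10; 11]; [:: 6; 7]; [:: 6; 7; 8; 13]; [:: 7; 8; 13; 14]; [:: 8; 13; 14]; [:: 14]; [:: 10; 11]; [:: 11; 12]; [:: 12]; [:: 13; 14]; [:: 14]])].

Definition fractional7 : seq (seq nat * seq (seq nat)) := [::
  ([:: 6; 1; 0; 0; 0; 0; 0],
   [:: [:: 6; 8]; [:: 7; 9]; [:: 9; 10]; [:: 10; 11]; [:: 11; 12]; [:: 12; 13]; [:: 13]]);
  ([:: 5; 0; 2; 0; 0; 1; 0],
   [:: [:: 5; 9]; [:: 6; 10]; [:: 7; 11]; [:: 10; 12]; [:: 11; 14]; [:: 12]; [::]; [:: 13]; [:: 14]]);
  ([:: 4; 2; 0; 4; 0; 0; 0],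
   [:: [:: 4; 7; 11; 13]; [:: 5; 8; 14]; [:: 8; 9; 15]; [:: 14; 16]; [:: 9; 15]; [:: 10; 12]; [:: 14; 16]; [:: 15]; [:: 12]; [:: 13]; [:: 14; 16]; [:: 15]; [:: 16]]);
  ([:: 4; 1; 1; 2; 1; 0; 0],
   [:: [:: 4; 4; 6; 8; 11; 11]; [:: 5; 5; 7; 9; 12; 12]; [:: 7; 7; 9; 12; 14; 14]; [:: 9; 9; 12; 14; 15; 15]; [:: 14; 15]; [:: 10; 11]; [:: 12; 15]; [:: 11; 13]; [:: 12; 14]; [:: 13]; [:: 14; 15]]);
  ([:: 5; 3; 2; 0; 0; 0; 0],
   [:: [:: 5; 9; 12]; [:: 6; 13]; [:: 10; 14]; [:: 13; 15]; [:: 16]; [:: 10; 14]; [:: 11]; [:: 13; 15]; [:: 14; 16]; [:: 15]; [::]; [:: 16]]);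
  ([:: 5; 0; 2; 0; 2; 0; 0],
   [:: [:: 5]; [:: 6; 10]; [:: 7; 11]; [:: 10; 14]; [:: 15]; [:: 11]; [:: 12]; [:: 13]; [:: 14]; [:: 15]]);
  ([:: 5; 0; 0; 4; 2; 0; 0],
   [:: [:: 5; 5; 10; 12; 12]; [:: 6; 7; 13]; [:: 6; 7; 8; 13; 16]; [:: 7; 8; 13; 16; 17]; [:: 8; 13; 16; 17]; [:: 13; 17]; [:: 10; 14; 14]; [:: 11; 15; 15]; [:: 12]; [:: 13; 16; 17]; [:: 16; 17]; [:: 17]]);
  ([:: 5; 0; 1; 0; 5; 0; 0],
   [:: [:: 5; 8; 13]; [:: 6; 9]; [:: 7; 10]; [:: 9; 16]; [:: 10; 17]; [::]; [:: 11; 14]; [:: 12; 15]; [::]; [:: 14]; [:: 15]; [:: 16]; [:: 17]]);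
  ([:: 4; 2; 2; 2; 0; 0; 0],
   [:: [:: 4; 7; 10; 13]; [:: 5; 8; 11; 14]; [:: 8; 14; 15]; [:: 15; 16]; [:: 11; 11]; [:: 12; 12]; [:: 14; 16]; [:: 15]; [:: 13]; [:: 14; 16]; [:: 15]; [::]; [:: 16]]);
  ([:: 5; 0; 1; 3; 1; 0; 0],
   [:: [:: 5; 5; 8; 12; 12]; [:: 6; 6; 13]; [:: 7; 7; 9; 13; 15]; [:: 9; 13; 15]; [:: 9; 13; 15; 16; 16]; [:: 16]; [:: 11]; [:: 12; 14]; [:: 13; 15]; [:: 14]; [:: 15; 16]; [:: 16]])].

(** The blue counts 3, 5, 7, 10, 13 are floor(m^2/4) + 1 for m = 3, ..., 7. *)
Lemma check3 : unpageable_check 3 3 fractional3. Proof. by vm_compute. Qed.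
Lemma check4 : unpageable_check 4 5 fractional4. Proof. by vm_compute. Qed.
Lemma check5 : unpageable_check 5 7 fractional5. Proof. by vm_compute. Qed.
Lemma check6 : unpageable_check 6 10 fractional6. Proof. by vm_compute. Qed.
Lemma check7 : unpageable_check 7 13 fractional7. Proof. by vm_compute. Qed.

Lemma unpageable_small k s : 2 <= k <= 6 ->
  count_mem true s = k.+1 -> count_mem false s = (k.+1 ^ 2 %/ 4).+1 -> ~ pageable k s.
Proof.
case: k => [|[|[|[|[|[|[|k]]]]]]] // _.
- exact: unpageable_checkP check3.
- exact: unpageable_checkP check4.
- exact: unpageable_checkP check5.
- exact: unpageable_checkP check6.
- exact: unpageable_checkP check7.
Qed.

(** With m = k+1, floor(m^2/4) is the product of [uphalf m] and [m./2], so the blue vertices exactly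
    fill the blocks. *)
Lemma planar_small k : 2 <= k <= 6 -> planar_check k.+1 (k.+1 ^ 2 %/ 4).
Proof. by case: k => [|[|[|[|[|[|[|k]]]]]]] // _; vm_compute. Qed.

Theorem theorem4 (k n : nat) :
  2 <= k <= 6 -> 0 < n ->
  let l := (k.+1 ^ 2) %/ 4 in
  let q := n %% l in
  book_crossing_number_is k k.+1 n
    (q * 'C((n - q) %/ l + 1, 2) + (l - q) * 'C((n - q) %/ l, 2)).
Proof.
move=> k_range n_gt0 l q; have /andP[k_gt1 _] := k_range.
have l_gt0 : 0 < l by rewrite divn_gt0 // (@leq_exp2r 2 _ 2) // ltnW.
rewrite -(sum_divn n l_gt0).
have lower D : \sum_(0 <= i < n) i %/ l <= @crossings k k.+1 n D.
  by apply: crossings_ge => // s; apply: unpageable_small.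
split=> //; have m_gt1 : 1 < k.+1 by rewrite ltnW.
have [D le_D] := drawing_with_clones m_gt1 l_gt0 n_gt0 (planar_small k_range).
by exists D; apply/eqP; rewrite eqn_leq le_D lower.
Qed.
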